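(* Let $n \ge 5$ and let $G$ be a subgroup of $S_n$. If $|G|$ is divisible by the denominator (in lowest terms) of the rational number $D_n/n!$, then $G$ is $A_n$ or $S_n$. In particular, if $C$ is any subset of $S_n$ (not necessarily a coset of $G$) with $|C|=|G|$ and $$\frac{|\{\sigma\in C : \sigma \text{ has no fixed points}\}|}{|C|}=\frac{D_n}{n!},$$ then $G$ is $A_n$ or $S_n$.
   Context: $S_n$ is the group of permutations of $\{1,\dots,n\}$ and $A_n$ is the alternating group. A permutation has no fixed points if $\sigma(i)\neq i$ for all $i$. $D_n$ is the number of elements of $S_n$ with no fixed points, so $D_n/n!=\sum_{i=0}^n (-1)^i/i!$. *)

(* Defs.v *)
From mathcomp Require Import all_boot all_order all_algebra all_fingroup all_solvable.

Set Implicit Arguments.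
Unset Strict Implicit.
Unset Printing Implicit Defensive.

Definition derangement (n : nat) (s : 'S_n) : bool := [forall i, s i != i].

Definition num_derangements (n : nat) : nat := #|[set s : 'S_n | derangement s]|.

(* Main.v *)
(**
The hypothesis says that the index t of G in S_n divides D_n.  The recurrence
D_n = n D_(n-1) + (-1)^n shows that D_n is congruent, up to sign, to 1 modulo n
and n - 2, to 2 modulo n - 3 and to 9 modulo n - 4; so t is almost coprime to
these numbers.

An orbit of size r forces 'C(n, r) to divide t, which with n | r 'C(n, r) gives
r = n.  For a transitive G a nontrivial block of size d forces 'C(n-1, d-1) to
divide t, which leaves only d = 2 with n even; then G contains a p-cycle for an
odd prime p | n - 3, and a p-cycle lies inside a block.  So G is primitive.

If no prime p <= n - 3 were coprime to t, then n would be odd, n - 3 a power of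
2 and n - 4 a power of 3, hence n = 5 or 7; n = 5 has p = 3.  Otherwise G
contains a p-cycle with p <= n - 3, and the theorem of Jordan applies.  For
n = 7, Jordan's chain of multiply transitive fixators of a 5-cycle gives
t | 24, while t | D_7 = 1854, so t <= 6, and a subgroup of index < n
contains A_n.
*)

Require Import Defs.
From mathcomp Require Import all_boot all_order all_algebra all_fingroup all_solvable.
From mathcomp Require Import zify ring.

Set Implicit Arguments.
Unset Strict Implicit.
Unset Printing Implicit Defensive.

Import GRing.Theory.

(** * Derangement numbers: inclusion-exclusion, recurrence, congruences *)

Section Derangements.

Local Open Scope ring_scope.

(** Distributing the product over [i] of [1 - (i \in A)] yields this signed sum, and any element of
    [A] contributes a zero factor. *)
Lemma sum_sign_subset (T : finType) (A : {set T}) :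
  \sum_(J : {set T} | J \subset A) (-1 : int) ^+ #|J| = (A == set0)%:R.
Proof.
have := bigA_distr 1 +%R (fun i : T => - (i \in A)%:R : int) (fun=> 1).
have -> : \prod_i (- (i \in A)%:R + 1 : int) = (A == set0)%:R.
  have [->|[x xA]] := set_0Vmem A.
    by rewrite eqxx big1 // => i _; rewrite inE oppr0 add0r.
  have /negPf-> : A != set0 by apply/set0Pn; exists x.
  by rewrite (bigD1 x) //= xA addNr mul0r.
move=> ->; rewrite big_mkcond; apply: eq_bigr => J _.
rewrite -big_mkcond /=; case: ifP => [/subsetP sJA|/negbT/subsetPn[x xJ xA]].
  rewrite (eq_bigr (fun=> -1)) ?prodr_const // => i /sJA ->.
  by rewrite mulr1n.
by rewrite (bigD1 x) //= (negPf xA) oppr0 mul0r.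
Qed.

(** Inclusion-exclusion over the set [J] of points required to be fixed: the permutations fixing [J]
    pointwise number [(n - #|J|)!]. The falling factorial [n ^_ (n - i)] is [n! / i!] written
    without division. *)
Lemma num_derangements_sum n :
  (num_derangements n)%:Z = \sum_(i < n.+1) (-1) ^+ i * (n ^_ (n - i))%:Z.
Proof.
transitivity (\sum_(J : {set 'I_n}) (-1 : int) ^+ #|J| * #|perm_on (~: J)|%:R).
  transitivity (\sum_(s : 'S_n) ([set i | s i == i] == set0)%:R : int).
    rewrite /num_derangements -sum1dep_card -natz natr_sum big_mkcond /=.
    apply: eq_bigr => s _; rewrite /derangement.
    have -> : ([set i | s i == i] == set0) = [forall i, s i != i].
      apply/eqP/forallP => [s0 i|s0]; last by apply/setP => i; rewrite !inE (negPf (s0 i)).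
      by move/setP/(_ i): s0; rewrite !inE => ->.
    by case: ifP.
  under eq_bigr do rewrite -sum_sign_subset big_mkcond.
  rewrite exchange_big /=; apply: eq_bigr => J _; rewrite -big_mkcond /=.
  rewrite sumr_const -[LHS]mulr_natr; congr (_ * (_)%:R); apply: eq_card => s.
  rewrite !unfold_in /=. apply/subsetP/subsetP => H i.
    by move=> sNi; rewrite inE; apply: contra sNi => /H; rewrite inE.
  by move=> iJ; rewrite inE; apply/negPn/negP => /H; rewrite inE iJ.
have cardJ (J : {set 'I_n}) : (#|J| < n.+1)%N.
  by rewrite ltnS -[X in (_ <= X)%N]card_ord max_card.
rewrite (partition_big (fun J : {set 'I_n} => Ordinal (cardJ J)) xpredT) //=.
apply: eq_bigr => i _.
rewrite (eq_bigr (fun=> (-1) ^+ i * ((n - i)`!)%:R)); last first.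
  move=> J /eqP <- /=; rewrite card_perm; congr (_ * (_`!)%:R).
  by rewrite cardsCs setCK card_ord.
rewrite sumr_const -mulrnAr; congr (_ * _).
rewrite (eq_card (B := [set J : {set 'I_n} | #|J| == i])); last by move=> J; rewrite !inE.
rewrite card_draws card_ord -mulr_natr -natrM mulnC -bin_sub; last by rewrite -ltnS.
by rewrite bin_ffact natz.
Qed.

Lemma num_derangementsS n :
  (num_derangements n.+1)%:Z = n.+1%:Z * (num_derangements n)%:Z + (-1) ^+ n.+1.
Proof.
rewrite !num_derangements_sum big_ord_recr /= subnn ffactn0 mulr1; congr (_ + _).
rewrite big_distrr; apply: eq_bigr => i _ /=.
by rewrite subSn -1?ltnS // ffactSS PoszM mulrCA.
Qed.

Lemma num_derangements0 : num_derangements 0 = 1%N.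
Proof.
by apply/eqP; rewrite -eqz_nat num_derangements_sum big_ord1 ffactn0.
Qed.

Lemma num_derangements_modn m :
  exists x : int, (num_derangements m)%:Z = m%:Z * x + (-1) ^+ m.
Proof.
case: m => [|m]; first by exists 0; rewrite num_derangements0.
by exists (num_derangements m)%:Z; rewrite num_derangementsS.
Qed.

(** Iterating the recurrence modulo [m] from [(-1) ^+ m], the numbers for [m], ..., [m + 4] are, up
    to that sign, 1, 0, 1, 2, 9. The case [m + 1] is absent because its residue 0 gives no
    restriction on [q]. *)
Lemma dvdn_num_derangements q m : (q %| m)%N ->
  [/\ (q %| num_derangements m)%N -> (q %| 1)%N,
      (q %| num_derangements m.+2)%N -> (q %| 1)%N,
      (q %| num_derangements m.+3)%N -> (q %| 2)%N &
      (q %| num_derangements m.+4)%N -> (q %| 9)%N].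
Proof.
move=> qm; have [x0 D0] := num_derangements_modn m.
have eps c (y : int) k : k%:Z = m%:Z * y + c%:Z * (-1) ^+ m ->
    (q %| k)%N -> (q %| c)%N.
  move=> kE qk; have : (q%:Z %| c%:Z * (-1) ^+ m)%Z.
    have -> : c%:Z * (-1) ^+ m = k%:Z - m%:Z * y by rewrite kE addrC addKr.
    by rewrite rpredB // dvdz_mulr.
  by rewrite -signr_odd; case: odd; rewrite /= ?mulr1 // mulrN1 rpredN.
pose x1 := m.+1%:Z * x0 + (-1) ^+ m; pose x2 := m.+2%:Z * x1.
pose x3 := m.+3%:Z * x2 + (-1) ^+ m; pose x4 := m.+4%:Z * x3 + 2 * (-1) ^+ m.
have D1 : (num_derangements m.+1)%:Z = m%:Z * x1.
  by rewrite num_derangementsS D0 /x1 exprS; ring.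
have D2 : (num_derangements m.+2)%:Z = m%:Z * x2 + (-1) ^+ m.
  by rewrite num_derangementsS D1 /x2 !exprS; ring.
have D3 : (num_derangements m.+3)%:Z = m%:Z * x3 + 2 * (-1) ^+ m.
  by rewrite num_derangementsS D2 /x3 !exprS; ring.
have D4 : (num_derangements m.+4)%:Z = m%:Z * x4 + 9 * (-1) ^+ m.
  by rewrite num_derangementsS D3 /x4 !exprS; ring.
split.
- by apply: (eps _ x0); rewrite mul1r.
- by apply: (eps _ x2); rewrite mul1r.
- exact: (eps _ x3).
- exact: (eps _ x4).
Qed.

Lemma num_derangements7 : num_derangements 7 = 1854%N.
Proof.
by apply/eqP; rewrite -eqz_nat !num_derangementsS num_derangements0.
Qed.

End Derangements.

(** * Blocks, primitivity and fixators *)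

Section Blocks.

Variable T : finType.
Implicit Types (G H : {group {perm T}}) (A B S Y : {set T}) (g h s : {perm T}) (x y : T).

Local Open Scope group_scope.

(** The usual condition that a translate of [B] equals [B] or is disjoint from it, phrased through a
    point of [B] whose image stays in [B]. *)
Definition block (H : {set {perm T}}) B :=
  [forall g in H, forall x in B, (g x \in B) ==> (g @: B == B)].

(** Primitivity is relative to a subset [S], so that it applies both to the whole group on all
    points and to the subgroup moving only the points of [S]. *)
Definition primitive_on (H : {set {perm T}}) S :=
  [transitive H, on S | 'P]
  && [forall B : {set T}, [&& B \subset S, 1 < #|B| & block H B] ==> (B == S)].

Lemma blockP (H : {set {perm T}}) B :
  reflect (forall g x, g \in H -> x \in B -> g x \in B -> g @: B = B) (block H B).
Proof.
apply: (iffP 'forall_in_'forall_in_implyP) => bB g; first by move=> x gH xB /(bB g gH x xB)/eqP.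
by move=> gH x xB gxB; apply/eqP/(bB _ x).
Qed.

Lemma primitive_onP (H : {set {perm T}}) S :
  reflect ([transitive H, on S | 'P] /\
           forall B, B \subset S -> 1 < #|B| -> block H B -> B = S) (primitive_on H S).
Proof.
apply: (iffP andP) => -[trS prS]; split=> //.
  by move=> B sBS B1 bB; apply/eqP; move/forall_inP: prS; apply; rewrite sBS B1.
by apply/forall_inP => B /and3P[sBS B1 bB]; apply/eqP/prS.
Qed.

Lemma astab_permP A s : reflect {in A, forall x, s x = x} (s \in 'C(A | 'P)).
Proof. by apply: (iffP astabP) => cA x /cA. Qed.

(** Mostly used with [A = ~: Y]: then this subgroup consists of the elements of [G] that move only
    points of [Y]. *)
Lemma fixatorP G A s :
  reflect (s \in G /\ {in A, forall x, s x = x}) (s \in 'C_G(A | 'P)).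
Proof. by rewrite inE; apply: (iffP andP) => -[sG /astab_permP]. Qed.

Lemma imset_fixator G Y s : s \in 'C_G(~: Y | 'P) -> s @: Y = Y.
Proof.
case/fixatorP => _ sF; apply/eqP; rewrite eqEcard card_imset ?leqnn ?andbT; last exact: perm_inj.
apply/subsetP => _ /imsetP[y yY ->]; apply: contraLR isT => syY.
by have /perm_inj syE : s (s y) = s y; [rewrite sF // inE | rewrite syE yY in syY].
Qed.

Lemma fixatorS G A B : A \subset B -> 'C_G(B | 'P) \subset 'C_G(A | 'P).
Proof. by move=> sAB; rewrite setIS // astabS. Qed.

Lemma atrans_permP (H : {group {perm T}}) S x : x \in S ->
  reflect ((forall g, g \in H -> g @: S \subset S) /\
    {in S, forall y, exists2 g, g \in H & g x = y}) [transitive H, on S | 'P].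
Proof.
move=> xS; apply: (iffP idP) => [trH|[actH trH]].
  split=> [g gH|y]; last by rewrite -(atransP trH x xS) => /orbitP[g gH <-]; exists g.
  apply/subsetP => _ /imsetP[y yS ->]; move: yS.
  by rewrite -(atransP trH x xS) => yx; rewrite -[g y]/('P%act y g) orbit_actr.
apply/imsetP; exists x => //; apply/eqP; rewrite eqEsubset; apply/andP; split.
  by apply/subsetP => y /trH[g gH <-]; apply: mem_orbit.
by apply/subsetP => _ /orbitP[g gH <-]; apply: (subsetP (actH g gH)); apply: imset_f.
Qed.

(** Orbit-stabiliser at a point [x] of [B], applied twice: the setwise stabiliser of [B] is
    transitive on [B], and it contains the whole stabiliser of [x] in [H]. *)
Lemma card_block_stab H S B : [transitive H, on S | 'P] -> B \subset S ->
  B != set0 -> block H B -> (#|'N_H(B | 'P)| * #|S| = #|B| * #|H|)%N.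
Proof.
move=> trH sBS /set0Pn[x xB] bB; have xS := subsetP sBS x xB.
have oB : orbit 'P 'N_H(B | 'P) x = B.
  apply/eqP; rewrite eqEsubset; apply/andP; split; apply/subsetP => y.
    by case/orbitP => g /setIP[_ /astabsP nB] <-; rewrite nB.
  move=> yB; have [_ /(_ y (subsetP sBS y yB))[g gH gx]] := elimT (atrans_permP H xS) trH.
  apply/orbitP; exists g => //; rewrite inE gH.
  have gB : g @: B = B by move/blockP: bB => /(_ g x gH xB); rewrite gx; apply.
  by rewrite -astab1_set; apply/astab1P.
have CN : 'C_('N_H(B | 'P))[x | 'P] = 'C_H[x | 'P].
  apply/setP => g; apply/setIP/setIP => -[gH gC]; split=> //.
    by case/setIP: gH.
  apply/setIP; split=> //; rewrite -astab1_set; apply/astab1P.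
  have /= gx := astab1P gC.
  by move/blockP: bB => /(_ g x gH xB); rewrite -[g x]/(aperm x g) gx; apply.
rewrite -(card_orbit_stab 'P 'N_H(B | 'P) x) -(card_orbit_stab 'P H x) oB CN (atransP trH) //.
by rewrite -mulnA [(#|S| * _)%N]mulnC.
Qed.

Lemma dvdn_card_block H S B : [transitive H, on S | 'P] -> B \subset S ->
  B != set0 -> block H B -> (#|B| %| #|S|)%N.
Proof.
move=> trH sBS B0 bB; have E := card_block_stab trH sBS B0 bB.
apply/dvdnP; exists #|H : 'N_H(B | 'P)|; apply/eqP.
rewrite -(eqn_pmul2l (cardG_gt0 'N_H(B | 'P))) E mulnA Lagrange ?subsetIl //.
by rewrite mulnC.
Qed.

Lemma primitive_on_prime H S : prime #|S| -> [transitive H, on S | 'P] -> primitive_on H S.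
Proof.
move=> pS trH; apply/primitive_onP; split=> // B sBS B1 bB.
have B0 : B != set0 by rewrite -card_gt0 ltnW.
have /(prime_nt_dvdP pS) := dvdn_card_block trH sBS B0 bB.
by move=> cB; apply/eqP; rewrite eqEcard sBS cB ?leqnn //; case: #|B| B1 => [|[]].
Qed.

(** Cauchy gives an element [c] of order [p]. It moves some point of [Y], whose orbit under [c] has
    length dividing [p] and so is all of [Y]. *)
Lemma atrans_prime_fixator G Y p : prime p -> #|Y| = p ->
  p %| #|'C_G(~: Y | 'P)| -> [transitive 'C_G(~: Y | 'P), on Y | 'P].
Proof.
move=> p_pr cY /(Cauchy p_pr)[c cF oc].
have [x xY cx] : exists2 x, x \in Y & c x != x.
  apply/exists_inP; apply: contraLR isT => /exists_inPn cY1.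
  have c1 : c = 1.
    apply/permP => x; rewrite perm1; case xY: (x \in Y); first by apply/eqP/negPn/cY1.
    by case/fixatorP: cF => _ -> //; rewrite inE xY.
  by move: oc p_pr; rewrite c1 order1 => <-.
have oY : orbit 'P <[c]> x = Y.
  have sY : orbit 'P <[c]> x \subset Y.
    apply/subsetP => _ /orbitP[g gc <-].
    have /imset_fixator <- : g \in 'C_G(~: Y | 'P) by apply: subsetP gc; rewrite cycle_subG.
    exact: imset_f.
  apply/eqP; rewrite eqEcard sY cY.
  have : #|orbit 'P <[c]> x| %| p by rewrite -oc; apply: dvdn_orbit.
  case/(primeP p_pr).2/orP => /eqP E; last by rewrite E leqnn.
  have := card_orbit1 E => /setP/(_ (c x)); rewrite inE (negPf cx).
  by rewrite (mem_orbit 'P x (cycle_id c)).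
apply/(atrans_permP _ xY); split=> [g /imset_fixator->|y] //.
rewrite -{1}oY => /orbitP[g gc <-]; exists g => //.
by apply: subsetP gc; rewrite cycle_subG.
Qed.

End Blocks.

(** * Orders and indices of permutation groups *)

(** The action restricted to [S] has kernel ['C_A(S | to)], so the quotient embeds into the
    symmetric group of [S]. *)
Lemma dvdn_indexg_astab (aT : finGroupType) (rT : finType) (to : {action aT &-> rT})
  (A : {group aT}) (S : {set rT}) :
  [acts A, on S | to]%g -> (#|A : 'C_A(S | to)|%g %| #|S|`!)%N.
Proof.
move=> actA; pose f := actperm <[actA]>%act.
have kerf : ('ker f = 'C_A(S | to))%g.
  by rewrite ker_actperm astab_actby setIT.
rewrite -kerf -[X in #|X : _|%g]setIid -card_morphim -perm.card_Sym.
apply: cardSg; apply/subsetP => _ /morphimP[g gA _ ->].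
rewrite inE; apply/subsetP => x; rewrite inE; apply: contraR => xS.
by rewrite actpermE /= /actby (negPf xS).
Qed.

Section Orders.

Variable T : finType.
Implicit Types (G H : {group {perm T}}) (A B S Y : {set T}) (g h s : {perm T}) (x y : T).

Local Open Scope group_scope.

Lemma dvdn_card_setstab H S : H \subset 'N(S | 'P) -> #|H| %| #|S|`! * #|~: S|`!.
Proof.
move=> actH; rewrite -(Lagrange (subsetIl H 'C(S | 'P))) mulnC.
apply: dvdn_mul; first exact: dvdn_indexg_astab.
rewrite -perm.card_Sym; apply: cardSg; apply/subsetP => s /fixatorP[_ sF].
rewrite inE; apply/subsetP => x; rewrite !inE; apply: contra => xS.
by rewrite sF.
Qed.

(** The core [C] of [G] is the kernel of the action on cosets, so its index divides the factorial of
    the index of [G], whence [#|C| >= #|T|]. As ['Alt_T] is simple, the normal subgroup [C] contains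
    it or meets it trivially, and the latter would force [#|C| <= 2]. *)
Lemma Alt_sub_small_index G : 4 < #|T| -> #|[set: {perm T}] : G| < #|T| -> 'Alt_T \subset G.
Proof.
move=> T4 Gt; set C := gcore G [set: {perm T}].
have nC : C <| [set: {perm T}] by apply: gcore_normal; apply: subsetT.
have T0 : 0 < #|T| by apply: leq_trans T4.
have C_large : #|T| <= #|C|.
  have := @dvdn_indexg_astab _ _ 'Rs%act [set: {perm T}]%G (rcosets G [set: {perm T}]).
  rewrite astabRs_rcosets setTI actsRs_rcosets => /(_ isT)/dvdn_leq -/(_ (fact_gt0 _)) leC.
  have le_fact : #|rcosets G [set: {perm T}]|`! <= #|T|.-1`!.
    rewrite leq_pfact ?inE; first by rewrite -ltnS prednK.
      exact: (indexg_gt0 [set: {perm T}] G).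
    by rewrite -ltnS prednK // (ltn_trans _ T4).
  have := Lagrange (subsetT C); rewrite [#|[set: _]|]card_Sym -[in RHS](prednK T0) factS (prednK T0).
  move=> LC; rewrite -(leq_pmul2r (fact_gt0 #|T|.-1)) -LC leq_mul2l orbC.
  by rewrite (leq_trans leC le_fact).
have sAC : C :&: 'Alt_T = 'Alt_T.
  have /simpleP[_ simA] := simple_Alt5 T4.
  have /simA[C1|//] : (C :&: 'Alt_T)%G <| 'Alt_T.
    by apply: normalS (normalI nC (Alt_normal T)); rewrite ?subsetIr ?subsetT.
  have := mul_cardG C 'Alt_T; rewrite [C :&: _]C1 cards1 muln1 => cCA.
  have : #|C * 'Alt_T| <= 2 * #|'Alt_T|.
    by rewrite card_Alt ?(ltn_trans _ T4) // -card_Sym subset_leq_card ?subsetT.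
  rewrite -cCA leq_pmul2r ?cardG_gt0 // => C2.
  by have := leq_trans T4 (leq_trans C_large C2).
by apply: subset_trans (gcore_sub G [set: {perm T}]); rewrite -/C -sAC subsetIl.
Qed.

Lemma Alt_or_Sym G : 1 < #|T| -> 'Alt_T \subset G -> G :=: 'Alt_T \/ G :=: 'Sym_T.
Proof.
move=> T1 sAG; have A0 : 0 < #|'Alt_T| by apply: cardG_gt0.
have : #|G : 'Alt_T| %| 2.
  rewrite -(dvdn_pmul2l A0) Lagrange // mulnC card_Alt // -card_Sym.
  by rewrite cardSg ?subsetT.
case/(primeP (isT : prime 2)).2/orP => /eqP iGA; [left | right]; apply/eqP.
  by rewrite eq_sym eqEcard sAG -(Lagrange sAG) iGA muln1 leqnn.
by rewrite eqEcard subsetT card_Sym -card_Alt // mulnC -iGA Lagrange // leqnn.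
Qed.

(** Since [p] does not divide the index, a Sylow [p]-subgroup of [G] is one of the full symmetric
    group, hence contains a conjugate of any [p]-cycle. *)
Lemma exists_prime_fixator G p : prime p -> p <= #|T| -> ~~ (p %| #|[set: {perm T}] : G|) ->
  exists2 Y : {set T}, #|Y| = p & p %| #|'C_G(~: Y | 'P)|.
Proof.
move=> p_pr leT piG.
have [A cA] : exists A : {set T}, #|A| = p.
  have : 0 < #|[set A : {set T} | #|A| == p]| by rewrite card_draws bin_gt0.
  by case/card_gt0P => A; rewrite inE => /eqP cA; exists A.
have [c cS oc] : {c : {perm T} | c \in perm.Sym A & #[c] = p}.
  by apply: Cauchy => //=; rewrite perm.card_Sym cA dvdn_fact // leqnn prime_gt0.
have [P sylP] := Sylow_exists p G.
have sylPT : p.-Sylow([set: {perm T}]) P.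
  rewrite pHallE subsetT (card_Hall sylP) -(Lagrange (subsetT G)) partnM //.
  rewrite -(p'natE _ p_pr) in piG.
  by rewrite [X in (_ * X)%N](part_p'nat piG) muln1 eqxx.
have [g _ sgP] : exists2 g, g \in [set: {perm T}] & <[c]> :^ g \subset P.
  by apply: (Sylow_Jsub sylPT); rewrite ?subsetT // /pgroup -/(#[c]) oc pnat_id.
exists (g @: A); first by rewrite card_imset //; apply: perm_inj.
have cgF : c ^ g \in 'C_G(~: (g @: A) | 'P).
  apply/fixatorP; split.
    by apply: (subsetP (subset_trans sgP (pHall_sub sylP))); rewrite memJ_conjg cycle_id.
  move=> x; rewrite inE -(permKV g x) (mem_imset _ _ (@perm_inj _ g)) => xA.
  rewrite permJ; congr (g _); apply/eqP; apply: contraR xA => cx.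
  by move: cS; rewrite inE => /subsetP; apply.
by rewrite -oc -(orderJ c g); apply: order_dvdG.
Qed.

End Orders.

(** * Jordan's extension of primitive fixators *)

Section Jordan.

Variable T : finType.
Implicit Types (G H : {group {perm T}}) (A B S Y : {set T}) (g h s t : {perm T}) (x y : T).

Local Open Scope group_scope.

Lemma imset_permM s t A : (s * t) @: A = t @: (s @: A).
Proof. by rewrite -imset_comp; apply: eq_imset => x; rewrite permM. Qed.

Lemma imset_perm1 A : (1 : {perm T}) @: A = A.
Proof. by rewrite -[RHS]imset_id; apply: eq_imset => x; rewrite perm1. Qed.

Lemma mem_imset_perm s A x : (s x \in s @: A) = (x \in A).
Proof. by rewrite mem_imset //; apply: perm_inj. Qed.

Lemma card_imset_perm s A : #|s @: A| = #|A|.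
Proof. by rewrite card_imset //; apply: perm_inj. Qed.

Lemma imset_permJ s t A : (s ^ t) @: (t @: A) = t @: (s @: A).
Proof. by rewrite -!imset_permM -conjgC. Qed.

Lemma imset_perm_id s A : {in A, forall x, s x = x} -> s @: A = A.
Proof. by move=> sA; rewrite -[RHS]imset_id; apply: eq_in_imset. Qed.

Lemma blockJ H B g : block H B -> block (H :^ g) (g @: B).
Proof.
move=> /blockP bB; apply/blockP => _ _ /imsetP[h hH ->] /imsetP[x xB ->].
by rewrite permJ mem_imset_perm imset_permJ => /(bB _ _ hH xB)->.
Qed.

Lemma atransJ H S g : [transitive H, on S | 'P] -> [transitive H :^ g, on g @: S | 'P].
Proof.
move=> trH; have [x xS _] := imsetP trH.
have [actH {}trH] := elimT (atrans_permP H xS) trH.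
have gxS : g x \in g @: S by rewrite mem_imset_perm.
apply/(atrans_permP (H :^ g)%G gxS); split=> [_ /imsetP[h hH ->]|_ /imsetP[y yS ->]].
  by rewrite imset_permJ imsetS ?actH.
by have [h hH <-] := trH y yS; exists (h ^ g); rewrite ?memJ_conjg ?permJ.
Qed.

Lemma primitive_onJ H S g : primitive_on H S -> primitive_on (H :^ g) (g @: S).
Proof.
case/primitive_onP => trH prH; apply/primitive_onP; split; first exact: atransJ.
move=> B sB B1 bB; have := prH (g^-1 @: B).
rewrite card_imset_perm => <- //; first by rewrite -imset_permM mulVg imset_perm1.
  by move/(imsetS g^-1): sB; rewrite -imset_permM mulgV imset_perm1.
by have := blockJ g^-1 (bB : block (H :^ g)%G B); rewrite /= conjsgK.
Qed.

Lemma fixatorJ G Y g : g \in G -> 'C_G(~: Y | 'P) :^ g = 'C_G(~: (g @: Y) | 'P).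
Proof.
have sub h Z : h \in G -> 'C_G(~: Z | 'P) :^ h \subset 'C_G(~: (h @: Z) | 'P).
  move=> hG; apply/subsetP => _ /imsetP[s /fixatorP[sG sF] ->].
  apply/fixatorP; split=> [|x]; first by rewrite groupJ.
  by rewrite inE -(permKV h x) mem_imset_perm permJ => xZ; rewrite sF // inE.
move=> gG; apply/eqP; rewrite eqEsubset sub //= -sub_conjgV.
by have := sub g^-1 (g @: Y); rewrite groupV -imset_permM mulgV imset_perm1; apply.
Qed.

(** Translate the block to [B'] meeting [Y]. If [Y] is not inside [B'], some [f] in the fixator
    takes a point of [B'] out of it, so [B'] has no point fixed by [f] and lies in [Y]. Primitivity
    in prime degree then makes [B'] equal to [Y], which [f] preserves: a contradiction. *)
Lemma leq_prime_card_block G B Y p : [transitive G, on [set: T] | 'P] ->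
  1 < #|B| -> block G B -> prime p -> #|Y| = p -> p %| #|'C_G(~: Y | 'P)| ->
  p <= #|B|.
Proof.
move=> trG B1 bB p_pr cY pF.
have trF := atrans_prime_fixator p_pr cY pF.
have prF : primitive_on 'C_G(~: Y | 'P) Y by apply: primitive_on_prime; rewrite ?cY.
have [y yY _] := imsetP trF.
have [b bB0] : exists b, b \in B by apply/card_gt0P/ltnW.
have [_ /(_ y (in_setT y))[g gG gb]] := elimT (atrans_permP G (in_setT b)) trG.
pose B' := g @: B; have cB' : #|B'| = #|B| by rewrite card_imset_perm.
have bB' : block G B' by have := blockJ g bB; rewrite conjGid.
have yB' : y \in B' by rewrite -gb mem_imset_perm.
have [actF trFy] := elimT (atrans_permP _ yY) trF.
rewrite -cB' -cY; apply/subset_leq_card/subsetP => _ /trFy[f fF <-].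
apply: contraLR isT => fyB'.
have /fixatorP[fG fix_f] := fF.
have sB'Y : B' \subset Y.
  apply/subsetP => z zB'; apply: contraR fyB' => zY.
  have fz : f z = z by rewrite fix_f // inE.
  by move/blockP: bB' => /(_ f z fG zB'); rewrite fz => <- //; rewrite mem_imset_perm.
have /primitive_onP[_ prFY] := prF.
have E : B' = Y.
  apply: prFY => //; first by rewrite cB'.
  by apply/blockP => h x /fixatorP[hG _]; apply: (elimT (blockP _ _) bB').
by move: fyB'; rewrite E; move/actF/subsetP: fF => /(_ (f y)); rewrite mem_imset_perm => ->.
Qed.

(* Take g in G with g Y <> Y meeting Y in as many points as possible.  If
   g Y \ Y had two points, primitivity of the fixator on g Y would give a
   translate of Y with a larger intersection; so g Y adds a single point x, and
   the fixator acts 2-transitively on x |: Y. *)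
Lemma primitive_fixator_extend G Y :
  primitive_on G [set: T] -> primitive_on 'C_G(~: Y | 'P) Y -> 1 < #|Y| -> Y != [set: T] ->
  exists2 x, x \notin Y & primitive_on 'C_G(~: (x |: Y) | 'P) (x |: Y).
Proof.
move=> prG prF Y1 YT.
have [trF prFY] := primitive_onP _ _ prF.
have [trG prGT] := primitive_onP _ _ prG.
pose P g := [&& g \in G, g @: Y != Y & Y :&: g @: Y != set0].
have [g0 Pg0] : exists g, P g.
  have : ~~ block G Y by apply: contra YT => /(prGT _ (subsetT _) Y1)/eqP.
  case/forall_inPn => g gG /forall_inPn[x xY]; rewrite negb_imply => /andP[gxY gY].
  by exists g; rewrite /P gG gY; apply/set0Pn; exists (g x); rewrite inE gxY mem_imset_perm.
case: (@arg_maxnP _ g0 P (fun g => #|Y :&: g @: Y|) Pg0) => g /and3P[gG gY gY0] gmax.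
set Y' := g @: Y in gY gY0 gmax *; set E := Y' :\: Y.
have cY' : #|Y'| = #|Y| by apply: card_imset_perm.
have prF' : primitive_on 'C_G(~: Y' | 'P) Y'.
  by rewrite -fixatorJ //; apply: primitive_onJ prF.
have [trF' prFY'] := primitive_onP _ _ prF'.
pose U := Y :|: Y'.
have UE : U :\: E = Y.
  by apply/setP => x; rewrite !inE; case: (x \in Y); case: (x \in Y').
have sEY' : E \subset Y' by apply: subsetDl.
have cE : #|Y :\: Y'| = #|E|.
  by apply/eqP; rewrite -(eqn_add2l #|Y :&: Y'|) cardsID setIC cardsID cY'.
have E0 : E != set0.
  apply: contra gY; rewrite setD_eq0 => sY'Y.
  by rewrite eqEcard sY'Y cY' leqnn.
have cE1 : #|E| = 1%N.
  apply/eqP; rewrite eqn_leq [X in _ && X]card_gt0 E0 andbT leqNgt; apply/negP => E1.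
  have EY' : E != Y'.
    apply: contra gY0 => /eqP/setDidPl; rewrite -setI_eq0 setIC; exact: id.
  have : ~~ block 'C_G(~: Y' | 'P) E by apply: contra EY' => /(prFY' _ sEY' E1)/eqP.
  case/forall_inPn => h hF' /forall_inPn[z zE]; rewrite negb_imply => /andP[hzE hE].
  have /fixatorP[hG fix_h] := hF'.
  have hY' : h @: Y' = Y'.
    apply/eqP; rewrite eqEcard card_imset_perm leqnn andbT.
    have [y yY' _] := imsetP trF'.
    by have [/(_ h hF')] := elimT (atrans_permP _ yY') trF'.
  have hU : h @: U = U.
    have -> : U = (Y :\: Y') :|: Y'.
      by apply/setP => x; rewrite !inE; case: (x \in Y); case: (x \in Y').
    rewrite imsetU hY' imset_perm_id // => x; rewrite inE => /andP[xY' _].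
    by apply: fix_h; rewrite inE.
  (* Inside [U] the sets [Y] and [h @: Y] are the complements of [E] and [h @: E]. So their
     intersection has size [#|U| - #|E :|: h @: E|], more than [#|Y :&: Y'| = #|U| - 2 * #|E|]
     because [E] and [h @: E] meet. *)
  have hY : h @: Y = U :\: h @: E.
    apply/setP => w; rewrite -(permKV h w) mem_imset_perm inE mem_imset_perm.
    by rewrite -hU mem_imset_perm -{1}UE inE.
  have sEU : E \subset U by rewrite (subset_trans sEY') ?subsetUr.
  have shEU : h @: E \subset U by rewrite -hU imsetS.
  have YhY : Y :&: h @: Y = U :\: (E :|: h @: E).
    by rewrite hY -{1}UE setDUr; apply/setP => w; rewrite !inE.
  have cU := cardsID E U; rewrite UE (setIidPr sEU) in cU.
  have cUE := cardsID (E :|: h @: E) U.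
  rewrite -YhY (setIidPr _) ?subUset ?sEU // in cUE.
  have cEE := cardsUI E (h @: E); rewrite card_imset_perm in cEE.
  have cY := cardsID Y' Y; rewrite cE in cY.
  have EhE : 0 < #|E :&: h @: E|.
    by apply/card_gt0P; exists (h z); rewrite inE hzE mem_imset_perm.
  have lt_h : #|Y :&: Y'| < #|Y :&: h @: Y|.
    move: cU cUE cEE cY EhE; move: (#|Y :&: h @: Y|) (#|Y :&: Y'|) (#|U|) (#|E|).
    move: (#|E :|: h @: E|) (#|E :&: h @: E|) (#|Y|); clear; lia.
  have Ph : P h.
    rewrite /P hG -card_gt0 (leq_trans _ lt_h) // andbT.
    apply: contra hE => /eqP hYY; apply/eqP/setP => w.
    have /setP/(_ w) := etrans (esym hYY) hY; have /subsetP/(_ w) := shEU.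
    rewrite !inE; case: (w \in h @: E) (w \in Y) (w \in Y') => [] [] [] //=.
    by move/(_ isT).
  by have /(leq_trans lt_h) := gmax _ Ph; rewrite ltnn.
have /cards1P[x Ex] : #|E| == 1%N by rewrite cE1.
have /setDP[xY' xY] : x \in E by rewrite Ex set11.
have Ux : U = x |: Y.
  by rewrite -Ex; apply/setP => y; rewrite !inE; case: (y \in Y); case: (y \in Y').
exists x => //; set F := 'C_G(_ | 'P).
have sF : 'C_G(~: Y | 'P) \subset F by apply: fixatorS; rewrite setCS subsetUr.
have sF' : 'C_G(~: Y' | 'P) \subset F by apply: fixatorS; rewrite setCS -Ux subsetUr.
have x0 : x \in x |: Y by apply: setU11.
have [y0 /setIP[y0Y y0Y']] := set0Pn _ gY0.
have [actF trFy] := elimT (atrans_permP _ y0Y) trF.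
have [actF' trFx] := elimT (atrans_permP _ xY') trF'.
have [k kF' kx] := trFx y0 y0Y'.
have actU (s : {perm T}) : s \in F -> s @: (x |: Y) = x |: Y by apply: imset_fixator.
have to_x y : y \in x |: Y -> exists2 s, s \in F & s x = y.
  case/setU1P => [->|/trFy[f fF fy]]; first by exists 1; rewrite ?group1 ?perm1.
  exists (k * f); last by rewrite permM kx fy.
  by rewrite groupM ?(subsetP sF f fF) ?(subsetP sF' k kF').
have trU : [transitive F, on x |: Y | 'P].
  by apply/(atrans_permP _ x0); split=> [s /actU->|].
apply/primitive_onP; split=> // B sB B1 bB.
(* The fixator on [Y] fixes [x], so it preserves a block through [x]; being transitive on [Y], it
   sweeps all of [Y] from a second point of the block. *)
have full_x B' : block F B' -> B' \subset x |: Y -> 1 < #|B'| -> x \in B' -> B' = x |: Y.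
  move=> /blockP bB' sB' B'1 xB'; apply/eqP; rewrite eqEsubset sB'.
  have [y yB' yx] : exists2 y, y \in B' & y != x.
    have /card_gt1P[u [v [uB' vB' uv]]] := B'1.
    by case: (eqVneq u x) => [ux|]; [exists v | exists u]; rewrite // eq_sym -ux.
  have yY : y \in Y by have := subsetP sB' y yB'; rewrite !inE (negPf yx).
  have [_ trFy'] := elimT (atrans_permP _ yY) trF.
  rewrite subUset sub1set xB' /=; apply/subsetP => z /trFy'[f fF <-].
  have /fixatorP[_ fix_f] := fF; have fx : f x = x by rewrite fix_f // inE.
  by rewrite -(bB' f x (subsetP sF f fF) xB') ?fx // mem_imset_perm.
have [b bB0] : exists b, b \in B by apply/card_gt0P/ltnW.
have [s sF0 sx] := to_x b (subsetP sB b bB0).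
have BE : B = s @: (s^-1 @: B) by rewrite -imset_permM mulVg imset_perm1.
rewrite BE (full_x (s^-1 @: B)) ?actU ?card_imset_perm //.
- by have := blockJ s^-1 bB; rewrite conjGid // groupV.
- by rewrite -(actU s^-1) ?groupV // imsetS.
- by rewrite -(permK s x) sx mem_imset_perm.
Qed.

End Jordan.

(** * Primitive groups containing a cycle of prime length *)

Section PrimitiveCycle.

Variable T : finType.
Implicit Types (G H : {group {perm T}}) (X Y : {set T}) (s w : {perm T}) (x y z : T).

Local Open Scope group_scope.

(** In other words, [G] has the same index in the symmetric group of [T] as the fixator has in that
    of [Y]. Adjoining one point at a time by [primitive_fixator_extend] multiplies the order of the
    fixator by [#|Y|.+1], by orbit-stabiliser at the new point. *)
Lemma card_primitive_fixator G Y : primitive_on G [set: T] ->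
  primitive_on 'C_G(~: Y | 'P) Y -> 1 < #|Y| ->
  (#|G| * #|Y|`! = #|T|`! * #|'C_G(~: Y | 'P)|)%N.
Proof.
move=> prG; have [m] := ubnP (#|T| - #|Y|); elim: m Y => // m IHm Y lt_m prY Y1.
have [->|YT] := eqVneq Y setT.
  have -> : 'C_G(~: [set: T] | 'P) = G.
    by rewrite setCT; apply/setIidPl/subsetP => s _; apply/astab_permP => z; rewrite inE.
  by rewrite cardsT mulnC.
have [x xY prxY] := primitive_fixator_extend prG prY Y1 YT.
have cxY : #|x |: Y| = #|Y|.+1 by rewrite cardsU1 xY.
have ltYT : #|Y| < #|T| by rewrite -cxY max_card.
have := IHm _ _ prxY; rewrite cxY => /(_ _ _)/=.
have -> : #|'C_G(~: (x |: Y) | 'P)| = (#|Y|.+1 * #|'C_G(~: Y | 'P)|)%N.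
  have [trxY _] := primitive_onP _ _ prxY.
  rewrite -(card_orbit_stab 'P _ x) (atransP trxY) ?setU11 // cxY; congr (_ * #|_|)%N.
  rewrite -setIA -astabU; congr 'C_G(_ | 'P); apply/setP => z.
  by rewrite !inE; case: eqVneq => [->|] //=; rewrite ?orbF.
rewrite factS mulnCA [RHS]mulnCA => H; apply/eqP; rewrite -(eqn_pmul2l (ltn0Sn #|Y|)).
apply/eqP/H; last by rewrite ltnS ltnW.
by rewrite subnS -ltnS prednK ?subn_gt0.
Qed.

(** Conjugation maps the normaliser into the automorphism group of a cyclic group, which is abelian,
    so commutators act trivially. *)
Lemma cyclic_normaliser_comm (gT : finGroupType) (a b c : gT) :
  a \in 'N(<[c]>) -> b \in 'N(<[c]>) -> commute [~ a, b] c.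
Proof.
move=> na nb; suff : [~ a, b] \in 'C(<[c]>).
  by move=> /centP/(_ c (cycle_id c)).
have /centsP abA : abelian (Aut <[c]>) by rewrite Aut_cyclic_abelian // cycle_cyclic.
rewrite -ker_conj_aut; apply/kerP; rewrite ?groupR // morphR //.
by apply/eqP/commgP/abA; apply: Aut_aut.
Qed.

(* [G] contains a p-cycle c with three fixed points x1, x2, x3 on which, by a
   Frattini argument, the normaliser of <[c]> induces the full symmetric group.
   The commutator w of two transpositions induces a 3-cycle there, centralises
   c and so acts on Y as a power of c, whence w ^+ p is a 3-cycle of G. *)
Lemma exists_3fixator G Y p : primitive_on G [set: T] -> prime p -> p != 3 ->
  #|Y| = p -> p %| #|'C_G(~: Y | 'P)| -> p + 3 <= #|T| ->
  exists2 X : {set T}, #|X| = 3 & 3 %| #|'C_G(~: X | 'P)|.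
Proof.
move=> prG p_pr p3 cY pF leT.
have extend Z : primitive_on 'C_G(~: Z | 'P) Z -> 1 < #|Z| -> #|Z| < #|T| ->
    exists2 x, x \notin Z & primitive_on 'C_G(~: (x |: Z) | 'P) (x |: Z).
  move=> prZ Z1 ltZ; apply: primitive_fixator_extend => //.
  by apply: contraTneq ltZ => ->; rewrite cardsT ltnn.
have prY : primitive_on 'C_G(~: Y | 'P) Y.
  by apply: primitive_on_prime; rewrite ?cY //; apply: atrans_prime_fixator pF.
have p1 := prime_gt1 p_pr.
have [x1 x1Y prY1] : exists2 x, x \notin Y & primitive_on 'C_G(~: (x |: Y) | 'P) (x |: Y).
  by apply: extend; rewrite ?cY //; lia.
set Y1 := x1 |: Y in prY1; have cY1 : #|Y1| = p.+1 by rewrite cardsU1 x1Y cY.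
have [x2 x2Y prY2] : exists2 x, x \notin Y1 & primitive_on 'C_G(~: (x |: Y1) | 'P) (x |: Y1).
  by apply: extend; rewrite ?cY1 //; lia.
set Y2 := x2 |: Y1 in prY2; have cY2 : #|Y2| = p.+2 by rewrite cardsU1 x2Y cY1.
have [x3 x3Y prY3] : exists2 x, x \notin Y2 & primitive_on 'C_G(~: (x |: Y2) | 'P) (x |: Y2).
  by apply: extend; rewrite ?cY2 //; lia.
set Y3 := x3 |: Y2 in prY3.
have [trY1 _] := primitive_onP _ _ prY1; have [trY2 _] := primitive_onP _ _ prY2.
have [trY3 _] := primitive_onP _ _ prY3.
clear extend prY1 prY2 prY3 cY1 cY2.
have [x12 x13 x23] : [/\ x1 != x2, x1 != x3 & x2 != x3].
  by move: x2Y x3Y; rewrite !inE !negb_or ![_ == x2]eq_sym ![_ == x3]eq_sym => /andP[-> _] /and3P[].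
have x2Y1 : x2 \notin Y1 := x2Y.
have x3Y2 : x3 \notin Y2 := x3Y.
have {}x2Y : x2 \notin Y by apply: contra x2Y; rewrite inE orbC => ->.
have {}x3Y : x3 \notin Y by apply: contra x3Y; rewrite !inE => ->; rewrite !orbT.
have Y3E z : (z \in Y3) = [|| z == x3, z == x2, z == x1 | z \in Y] by rewrite !inE.
(* Triple transitivity: [h3] places [x3], then [h2] adjusts [x2] while fixing [x3], then [h1]
   adjusts [x1] while fixing both. *)
have tr3 y1 y2 y3 : y1 \in Y3 -> y2 \in Y3 -> y3 \in Y3 -> y1 != y2 -> y1 != y3 -> y2 != y3 ->
    exists2 h, h \in 'C_G(~: Y3 | 'P) & [/\ h x1 = y1, h x2 = y2 & h x3 = y3].
  move=> y1Y y2Y y3Y y12 y13 y23.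
  have sF2 : 'C_G(~: Y2 | 'P) \subset 'C_G(~: Y3 | 'P) by apply: fixatorS; rewrite setCS subsetUr.
  have sF1 : 'C_G(~: Y1 | 'P) \subset 'C_G(~: Y2 | 'P) by apply: fixatorS; rewrite setCS subsetUr.
  have inv (Z : {set T}) h z : h \in 'C_G(~: Z | 'P) -> z \in Z -> h^-1 z \in Z.
    by move=> hF zZ; rewrite -(mem_imset_perm h) permKV (imset_fixator hF).
  have out (Z : {set T}) h z : h \in 'C_G(~: Z | 'P) -> z \notin Z -> h z = z.
    by case/fixatorP => _ hF zZ; rewrite hF // inE.
  have [_ /(_ _ y3Y)[h3 h3F h3x]] := elimT (atrans_permP _ (setU11 x3 Y2)) trY3.
  have inY2 z : z \in Y3 -> z != y3 -> h3^-1 z \in Y2.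
    move=> zY zy3; have := inv _ _ _ h3F zY; rewrite /Y3 in_setU1 => /orP[/eqP h3z|//].
    by rewrite -h3x -h3z permKV eqxx in zy3.
  have [_ /(_ _ (inY2 _ y2Y y23))[h2 h2F h2x]] := elimT (atrans_permP _ (setU11 x2 Y1)) trY2.
  have h1Y : h2^-1 (h3^-1 y1) \in Y1.
    have := inv _ _ _ h2F (inY2 _ y1Y y13); rewrite /Y2 in_setU1 => /orP[/eqP h2z|//].
    by case/eqP: y12; apply: (@perm_inj _ h3^-1); rewrite -h2x -h2z permKV.
  have [_ /(_ _ h1Y)[h1 h1F h1x]] := elimT (atrans_permP _ (setU11 x1 Y)) trY1.
  exists (h1 * h2 * h3).
    by rewrite !groupM // (subsetP sF2) // (subsetP sF1).
  split; rewrite !permM.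
  - by rewrite h1x !permKV.
  - by rewrite (out _ _ _ h1F) // h2x permKV.
  - by rewrite (out _ _ _ (subsetP sF1 _ h1F)) // (out _ _ _ h2F).
have [c cF oc] := Cauchy p_pr pF.
(* The order of the fixator divides [p!], which contains [p] exactly once; Wilson's theorem shows
   that [p] does not divide [(p - 1)!]. *)
have sylc : p.-Sylow('C_G(~: Y | 'P)) <[c]>.
  rewrite pHallE cycle_subG cF /= -/(#[c]) oc p_part.
  suff -> : logn p #|'C_G(~: Y | 'P)| = 1%N by rewrite expn1.
  apply/eqP; rewrite eqn_leq logn_gt0 mem_primes p_pr cardG_gt0 pF /= andbT.
  have cFp : #|'C_G(~: Y | 'P)| %| p`!.
    rewrite -cY -perm.card_Sym; apply: cardSg; apply/subsetP => s /fixatorP[_ sF].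
    by rewrite inE; apply/subsetP => z; rewrite inE; apply: contraR => zY; rewrite sF // inE.
  apply: leq_trans (dvdn_leq_log p (fact_gt0 p) cFp) _.
  rewrite -(prednK (prime_gt0 p_pr)) factS lognM ?fact_gt0 // prednK ?prime_gt0 //.
  rewrite logn_prime // eqxx addnC lognE p_pr fact_gt0 /=.
  case: ifP => // p_dv; have := p_pr; rewrite Wilson // -addn1 dvdn_addr // dvdn1 => /eqP pE.
  by rewrite pE in p1.
(* Sylow conjugacy gives [k] in the fixator undoing the effect of [s] on [<[c]>]; as [k] fixes every
   point outside [Y], the correction [s * k^-1] still acts there as [s]. *)
have normalise s : s \in 'C_G(~: Y3 | 'P) -> s @: Y = Y ->
    exists a, [/\ a \in G, a \in 'N(<[c]>), a @: Y = Y & {in ~: Y, a =1 s}].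
  move=> sF sY; have sG : s \in G by case/fixatorP: sF.
  have FJ : 'C_G(~: Y | 'P) :^ s = 'C_G(~: Y | 'P) by rewrite fixatorJ // sY.
  have sylcJ : p.-Sylow('C_G(~: Y | 'P)) (<[c]> :^ s)%G by rewrite -{1}FJ pHallJ2.
  have [k kF /= kE] := Sylow_trans sylc sylcJ; have /fixatorP[kG fix_k] := kF.
  exists (s * k^-1); split; first by rewrite groupM // groupV.
  - by apply/normP; rewrite conjsgM kE conjsgK.
  - by rewrite imset_permM sY (imset_fixator (groupVr kF)).
  move=> z; rewrite inE => zY; rewrite permM; apply: (@perm_inj _ k); rewrite permKV fix_k //.
  by rewrite inE -{1}sY mem_imset_perm.
have preserve s : s \in 'C_G(~: Y3 | 'P) -> {subset [:: x1; x2; x3] <= [:: s x1; s x2; s x3]} ->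
    s @: Y = Y.
  move=> sF sX; apply/eqP; rewrite eqEcard card_imset_perm leqnn andbT.
  apply/subsetP => _ /imsetP[y yY ->].
  have : s y \in Y3 by rewrite -(imset_fixator sF) mem_imset_perm Y3E yY !orbT.
  have notX : s y \notin [:: x1; x2; x3].
    apply/negP => /sX; rewrite !inE => /or3P[] /eqP/perm_inj yE; move: yY; rewrite yE.
    - exact/negP.
    - exact/negP.
    - exact/negP.
  by move: notX; rewrite Y3E !inE !negb_or => /and3P[/negPf-> /negPf-> /negPf->].
have [a0 a0F [a01 a02 a03]] :
    exists2 h, h \in 'C_G(~: Y3 | 'P) & [/\ h x1 = x2, h x2 = x1 & h x3 = x3].
  by apply: tr3; rewrite ?Y3E ?eqxx ?orbT // eq_sym.
have [b0 b0F [b01 b02 b03]] :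
    exists2 h, h \in 'C_G(~: Y3 | 'P) & [/\ h x1 = x1, h x2 = x3 & h x3 = x2].
  by apply: tr3; rewrite ?Y3E ?eqxx ?orbT // eq_sym.
have [||a [aG na aY aE]] := normalise a0 => //.
  by apply: preserve => // z; rewrite a01 a02 a03 !inE orbCA.
have [||b [bG nb bY bE]] := normalise b0 => //.
  by apply: preserve => // z; rewrite b01 b02 b03 !inE [(z == x3) || _]orbC.
pose w := [~ a, b]; have wG : w \in G by rewrite groupR.
have cwc : commute w c := cyclic_normaliser_comm na nb.
have wY : w @: Y = Y.
  have inv s : s @: Y = Y -> s^-1 @: Y = Y.
    by move=> sY; rewrite -{1}sY -imset_permM mulgV imset_perm1.
  by rewrite /w commgEl /conjg !imset_permM (inv a) // (inv b) // aY.
have [wx1 wx2 wx3] : [/\ w x1 = x2, w x2 = x3 & w x3 = x1].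
  have [a1 a2 a3] : [/\ a^-1 x2 = x1, a^-1 x1 = x2 & a^-1 x3 = x3].
    by split; apply: (@perm_inj _ a); rewrite permKV aE ?inE.
  have [b1 b2 b3] : [/\ b^-1 x1 = x1, b^-1 x3 = x2 & b^-1 x2 = x3].
    by split; apply: (@perm_inj _ b); rewrite permKV bE ?inE.
  rewrite /w commgEl /conjg; split; rewrite !permM ?a1 ?a2 ?a3 ?b1 ?b2 ?b3.
  - by rewrite aE ?inE // a03 bE ?inE.
  - by rewrite aE ?inE // a01 bE ?inE.
  - by rewrite aE ?inE // a02 bE ?inE.
have w_out z : z \notin Y3 -> w z = z.
  move=> zY3; have zY : z \in ~: Y.
    by rewrite inE; apply: contra zY3; rewrite Y3E => ->; rewrite !orbT.
  have az : a z = z by rewrite aE //; case/fixatorP: a0F => _; apply; rewrite inE.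
  have bz : b z = z by rewrite bE //; case/fixatorP: b0F => _; apply; rewrite inE.
  by rewrite /w commgEl /conjg !permM -{1}az permK -{1}bz permK az bz.
have w_in y : y \in Y -> (w ^+ p) y = y.
  have trc : [transitive 'C_(<[c]>)(~: Y | 'P), on Y | 'P].
    apply: (atrans_prime_fixator p_pr cY); rewrite -oc order_dvdG //.
    by rewrite inE cycle_id; case/setIP: cF.
  move=> yY; have [_ trcy] := elimT (atrans_permP _ yY) trc.
  have [f fF fy] : exists2 f, f \in 'C_(<[c]>)(~: Y | 'P) & f y = w y.
    by apply: trcy; rewrite -wY mem_imset_perm.
  have /setIP[fc _] := fF.
  have cent e : e \in <[c]> -> commute w e by case/cycleP => i ->; apply: commuteX.
  (* Both [w] and [f] commute with [<[c]>], which is transitive on [Y], so agreement at the one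
     point [y] spreads to all of [Y]. *)
  have wf z : z \in Y -> w z = f z.
    move/trcy => [e /setIP[ec _] <-]; rewrite -permM -(cent e ec) permM -fy -!permM.
    by congr (fun_of_perm _ y); apply: (centsP (cycle_abelian c)).
  have : (w ^+ p) y = (f ^+ p) y.
    have fY z : z \in Y -> f z \in Y by move=> zY; rewrite -(imset_fixator fF) mem_imset_perm.
    have iterY n : iter n f y \in Y by elim: n => //= n; apply: fY.
    by rewrite !permX; elim: (p) => //= n ->; rewrite wf.
  have -> : f ^+ p = 1 by apply/eqP; rewrite -order_dvdn -oc; apply: order_dvdG fc.
  by rewrite perm1.
pose X := [set x1; x2; x3].
have cX : #|X| = 3 by rewrite /X -setUA !cardsU1 cards1 !inE x23 negb_or x12 x13.
exists X => //.
pose u := w ^+ p; have uF : u \in 'C_G(~: X | 'P).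
  apply/fixatorP; split=> [|z]; first by rewrite groupX.
  rewrite !inE !negb_or => /andP[/andP[z1 z2] z3].
  case zY: (z \in Y); first exact: w_in.
  have wz : w z = z by apply: w_out; rewrite Y3E zY (negPf z1) (negPf z2) (negPf z3).
  by rewrite permX; elim: p {w_in prG p_pr p3 cY pF leT p1 oc sylc u} => //= k ->.
have w3 z : z \in X -> (w ^+ 3) z = z.
  by rewrite permX !inE -orbA => /or3P[] /eqP->; rewrite /= ?wx1 ?wx2 ?wx3 ?wx1 ?wx2.
have u3 : u ^+ 3 = 1.
  apply/permP => z; rewrite perm1; case zX: (z \in X).
    rewrite /u expgAC permX; elim: (p) => //= k ->; exact: w3.
  have [_ uz] := elimT (fixatorP _ _ _) uF.
  by rewrite permX /= !uz // inE zX.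
(* On [X] the element [u] acts as [w ^+ (p %% 3)], and [p %% 3] is nonzero since [p] is a prime
   other than 3. *)
have u1 : u != 1.
  apply/eqP => /permP/(_ x1); rewrite perm1 /u (divn_eq p 3) expgD permM.
  have -> : (w ^+ (p %/ 3 * 3)) x1 = x1.
    by rewrite mulnC expgM permX; elim: (p %/ 3) => //= k ->; apply: w3; rewrite !inE eqxx.
  have : p %% 3 != 0%N.
    by apply: contra p3 => d3; rewrite eq_sym -dvdn_prime2.
  have := ltn_pmod p (isT : 0 < 3); case: (p %% 3) => [|[|[|]]] // _ _.
    by rewrite expg1 wx1 => /eqP; rewrite eq_sym (negPf x12).
  by rewrite permX /= wx1 wx2 => /eqP; rewrite eq_sym (negPf x13).
have <- : #[u] = 3.
  have : #[u] %| 3 by rewrite order_dvdn u3.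
  by case/(primeP (isT : prime 3)).2/orP => /eqP //= /eqP; rewrite order_eq1 (negPf u1).
exact: order_dvdG.
Qed.

(** Jordan's theorem. A larger [p] is first traded for 3; with [q <= 3], [card_primitive_fixator]
    shows that the index of [G] divides [(q - 1)!], hence is at most 2. *)
Lemma Alt_sub_primitive_cycle G Y p : primitive_on G [set: T] -> prime p -> #|Y| = p ->
  p %| #|'C_G(~: Y | 'P)| -> (p <= 3) || (p + 3 <= #|T|) -> 4 < #|T| -> 'Alt_T \subset G.
Proof.
move=> prG p_pr cY pF p_small T4.
have [q [X [q_pr q3 cX qF]]] : exists q X, [/\ prime q, q <= 3, #|X| = q & q %| #|'C_G(~: X | 'P)|].
  case: leqP p_small => [p3 _|p3 /= p_small]; first by exists p, Y.
  have [|X cX XF] := exists_3fixator prG p_pr _ cY pF p_small; first by rewrite neq_ltn p3 orbT.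
  by exists 3, X.
have prX : primitive_on 'C_G(~: X | 'P) X.
  by apply: primitive_on_prime; rewrite ?cX //; apply: atrans_prime_fixator qF.
have := card_primitive_fixator prG prX; rewrite cX => /(_ (prime_gt1 q_pr)).
case/dvdnP: qF => r ->; rewrite -card_Sym -(Lagrange (subsetT G)) -mulnA.
move/eqP; rewrite eqn_pmul2l ?cardG_gt0 // -{1}(prednK (prime_gt0 q_pr)) factS prednK ?prime_gt0 //.
rewrite [(r * q)%N]mulnC mulnCA eqn_pmul2l ?prime_gt0 // => /eqP qE.
apply: Alt_sub_small_index => //; apply: leq_ltn_trans (dvdn_leq (fact_gt0 q.-1) _) _.
  by rewrite qE dvdn_mulr.
by case: q q3 {q_pr cX qE} => [|[|[|[|]]]] //= _; apply: leq_ltn_trans T4.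
Qed.

(** * Binomial coefficients dividing the index *)

Lemma dvdn_bin_setstab G S : G \subset 'N(S | 'P) ->
  'C(#|T|, #|S|) %| #|[set: {perm T}] : G|.
Proof.
move=> /dvdn_card_setstab/dvdnP[u uE]; apply/dvdnP; exists u; apply/eqP.
rewrite -(eqn_pmul2l (cardG_gt0 G)) Lagrange ?subsetT // card_Sym.
have := cardsC S => cST; rewrite -(@bin_fact #|T| #|S|) ?max_card //.
by rewrite -{2}cST addKn uE mulnCA mulnA [(#|G| * _)%N]mulnC.
Qed.

(** With [N] the stabiliser of [B], [card_block_stab] turns the index of [G] into
    [(#|T| - 1)! * #|B| / #|N|], and [#|N|] divides [#|B|! * (#|T| - #|B|)!]. *)
Lemma dvdn_bin_block G B : [transitive G, on [set: T] | 'P] -> B != set0 -> block G B ->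
  'C(#|T|.-1, #|B|.-1) %| #|[set: {perm T}] : G|.
Proof.
move=> trG B0 bB; have := card_block_stab trG (subsetT B) B0 bB; rewrite cardsT.
set N := 'N_G(B | 'P) => NE; have B1 : 0 < #|B| by rewrite card_gt0.
have T0 : 0 < #|T| by apply: leq_trans B1 (max_card _).
have /dvdn_card_setstab/dvdnP[u uE] : N \subset 'N(B | 'P) by apply: subsetIr.
have LT := Lagrange (subsetT G); rewrite card_Sym in LT.
have := cardsC B => cBT; have := @bin_fact #|T| #|B| (max_card _).
rewrite -{2}cBT addKn uE => binE.
have := mul_bin_diag #|T| #|B|.-1; rewrite prednK // => diag.
apply/dvdnP; exists u; apply/eqP; rewrite -(eqn_pmul2l T0) -(eqn_pmul2l (cardG_gt0 N)).
rewrite mulnA NE -mulnA LT -binE mulnA -diag; apply/eqP.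
by move: #|N| #|T| 'C(_, _) => a b c; ring.
Qed.

End PrimitiveCycle.

(** * Arithmetic of an index [t] almost coprime to [n], [n - 2], [n - 3] and [n - 4] *)

Section Arithmetic.

Variables (n t : nat).
Hypothesis n5 : (5 <= n)%N.
Hypothesis t_n : forall q, (q %| n)%N -> (q %| t)%N -> (q %| 1)%N.
Hypothesis t_n2 : forall q, (q %| n - 2)%N -> (q %| t)%N -> (q %| 1)%N.
Hypothesis t_n3 : forall q, (q %| n - 3)%N -> (q %| t)%N -> (q %| 2)%N.
Hypothesis t_n4 : forall q, (q %| n - 4)%N -> (q %| t)%N -> (q %| 9)%N.

Local Open Scope nat_scope.

Lemma orbit_size_eq r : 0 < r <= n -> 'C(n, r) %| t -> r = n.
Proof.
case/andP=> r0 rn Ct; have := mul_bin_diag n r.-1; rewrite prednK // => E.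
have co : coprime n 'C(n, r).
  by rewrite /coprime -dvdn1 t_n ?dvdn_gcdl // (dvdn_trans (dvdn_gcdr _ _) Ct).
have : n %| r * 'C(n, r) by rewrite -E dvdn_mulr.
by rewrite Gauss_dvdl // => /(dvdn_leq r0) nr; apply/eqP; rewrite eqn_leq rn nr.
Qed.

(** Coprimality of [n - 2] with the binomial gives [n - 2 %| (d - 1) * (d - 2)], and for [d >= 3]
    this leaves only [n = 2 * d]. Then [n - 3] is odd, so also coprime to the binomial, and divides
    [(d - 1) ^ 2 * d]; being coprime to [d - 1] it divides [d]. Hence [d = 3] and [n = 6], against
    the first divisibility. *)
Lemma block_size_eq2 d : d %| n -> 1 < d < n -> 'C(n.-1, d.-1) %| t -> d = 2.
Proof.
move=> /dvdnP[m nE] /andP[d1 dn] Ct; set C := 'C(n.-1, d.-1) in Ct.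
have co2 : coprime (n - 2) C.
  by rewrite /coprime -dvdn1 t_n2 ?dvdn_gcdl // (dvdn_trans (dvdn_gcdr _ _) Ct).
have E1 : n.-1 * 'C(n.-2, d.-2) = d.-1 * C.
  by rewrite mul_bin_diag -/C; case: d d1 @C {nE dn Ct co2} => [|[]].
have E2 : n.-2 * 'C(n.-2.-1, d.-2) = (n - d) * 'C(n.-2, d.-2).
  by rewrite mul_bin_down; congr (_ * _); lia.
have E3 : n.-2.-1 * 'C(n.-2.-2, d.-2) = (n - d - 1) * 'C(n.-2.-1, d.-2).
  by rewrite mul_bin_down; congr (_ * _); lia.
have D2 : n - 2 %| d.-1 * (n - d).
  rewrite -(Gauss_dvdl _ co2); apply/dvdnP; exists (n.-1 * 'C(n.-2.-1, d.-2)).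
  by rewrite mulnAC -E1 -mulnA [_ * (n - d)]mulnC -E2 subn2 mulnA mulnAC.
have {}D2 : n - 2 %| d.-1 * (d - 2).
  rewrite -(dvdn_addr _ D2) -mulnDr; apply/dvdn_mull; suff -> : n - d + (d - 2) = n - 2 by [].
  by lia.
apply/eqP; apply: contraT => d2; exfalso.
have [e dE] : exists e, d = e.+3 by exists (d - 3); lia.
have m2 : m = 2.
  have [k kE] := dvdnP D2.
  have knE : e.+2 * e.+1 + 2 * k = k * m * d.
    have -> : e.+2 * e.+1 = k * (n - 2) by rewrite -kE dE subn2.
    by rewrite [2 * k]mulnC -mulnDr subnK ?(leq_trans _ n5) // nE mulnA.
  (* Modulo [d] the product [(d - 1) * (d - 2)] is 2. The resulting bound [d <= 2 * k + 2], put into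
     [k * (m * d - 2) = (d - 1) * (d - 2)], forces [m <= 2]. *)
  have : d %| 2 * k + 2.
    rewrite -(dvdn_addr _ (dvdn_mulr e (dvdnn d))).
    by have -> : d * e + (2 * k + 2) = k * m * d; [rewrite -knE dE; ring | rewrite dvdn_mull].
  rewrite addn2 => /dvdn_leq dk; move: knE (dk isT) dn; rewrite nE dE; clear; nia.
have co3 : coprime (n - 3) C.
  have := t_n3 (dvdn_gcdl (n - 3) C) (dvdn_trans (dvdn_gcdr _ _) Ct).
  case/(primeP (isT : prime 2)).2/orP => // /eqP g2; exfalso.
  have := dvdn_gcdl (n - 3) C; rewrite g2.
  by rewrite nE m2 dE; lia.
have : n - 3 %| d.-1 * (d.-1 * d).
  rewrite -(Gauss_dvdl _ co3); apply/dvdnP; exists (n.-1 * n.-2 * 'C(n.-2.-2, d.-2)).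
  have nd : n - d = d by rewrite nE m2; lia.
  rewrite nd in E2; rewrite nd subn1 in E3.
  have -> : d.-1 * (d.-1 * d) * C = d.-1 * d * (d.-1 * C) by ring.
  rewrite -E1 (_ : n - 3 = n.-2.-1); last by lia.
  have -> : d.-1 * d * (n.-1 * 'C(n.-2, d.-2)) = d.-1 * n.-1 * (d * 'C(n.-2, d.-2)) by ring.
  rewrite -E2.
  have -> : d.-1 * n.-1 * (n.-2 * 'C(n.-2.-1, d.-2)) = n.-1 * n.-2 * (d.-1 * 'C(n.-2.-1, d.-2)) by ring.
  by rewrite -E3; ring.
have n3 : n - 3 = (2 * e).+3 by rewrite nE m2 dE; lia.
have cop : coprime (n - 3) d.-1.
  have : coprime (n - 3) (2 * d.-1).
    have -> : 2 * d.-1 = (n - 3).+1 by rewrite n3 dE; lia.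
    exact: coprimenS.
  by rewrite coprimeMr => /andP[].
rewrite !Gauss_dvdr // => /(dvdn_leq (ltnW d1)) le3.
have e0 : e = 0 by move: le3; rewrite n3 dE; lia.
by move: D2; rewrite nE m2 dE e0.
Qed.

(** The alternatives on [p] are those of [Alt_sub_primitive_cycle]. The value 7 is set apart because
    4 and 3 are powers of 2 and of 3. *)
Lemma exists_prime_ndvd_index : n != 7 ->
  exists p, [/\ prime p, (p <= 3) || (p + 3 <= n), p <= n & ~~ (p %| t)].
Proof.
move=> n7; suff : ~~ [forall p : 'I_n.+1, prime p && ((p <= 3) || (p + 3 <= n)) ==> (p %| t)].
  case/forallPn => p; rewrite negb_imply => /andP[/andP[p_pr ps] pt].
  by exists p; split=> //; rewrite -ltnS ltn_ord.
apply/negP => /forallP all_t.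
have {}all_t p : prime p -> p <= n -> (p <= 3) || (p + 3 <= n) -> p %| t.
  by rewrite -ltnS => p_pr pn ps; have := all_t (Ordinal pn); rewrite /= p_pr ps.
have n_odd : odd n.
  apply: contraT => n_even; have : 2 %| n by rewrite dvdn2.
  by move=> /t_n; rewrite all_t //; [move=> /(_ isT)|lia].
have n_n5 : n != 5.
  apply/eqP => nE; have : 3 %| n - 2 by rewrite nE.
  by move=> /t_n2; rewrite all_t //; [move=> /(_ isT)|lia].
have /p_natP[a aE] : 2.-nat (n - 3).
  apply/pnatP => [|p p_pr pn]; first by lia.
  have le : p <= n - 3 by apply: dvdn_leq pn; lia.
  have := t_n3 pn; rewrite all_t => //; [|lia|lia].
  by move/(_ isT); rewrite dvdn_prime2.
have /p_natP[b bE] : 3.-nat (n - 4).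
  apply/pnatP => [|p p_pr pn]; first by lia.
  have le : p <= n - 4 by apply: dvdn_leq pn; lia.
  have := t_n4 pn; rewrite all_t => //; [|lia|lia].
  by move/(_ isT); rewrite (Euclid_dvdM 3 3) // orbb dvdn_prime2.
(* Hence [2 ^ a = 3 ^ b + 1] is not divisible by 8, so [n - 3] is 1, 2 or 4. *)
have b8 : (3 ^ b %% 8 == 1) || (3 ^ b %% 8 == 3).
  by elim: (b) => // i; rewrite expnS -modnMmr; case/orP => /eqP->.
have a2 : a <= 2.
  rewrite leqNgt; apply/negP => a2.
  have : 8 %| n - 3 by rewrite aE (@dvdn_exp2l 2 3).
  by lia.
by move: aE n_odd n_n5 n7; case: a a2 => [|[|[|]]] //= _ aE; lia.
Qed.

End Arithmetic.

(** * Transitivity, primitivity and the conclusion for an index dividing the derangement number *)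

Lemma Alt_sub_dvd_num_derangements (n : nat) (G : {group 'S_n}) : (5 <= n)%N ->
  (#|[set: 'S_n] : G|%g %| num_derangements n)%N -> ('Alt_('I_n) \subset G)%g.
Proof.
move=> n5; set t := #|_ : _|%g => tD; have card_n : #|'I_n| = n := card_ord n.
have t_n q : (q %| n)%N -> (q %| t)%N -> (q %| 1)%N.
  by move=> /dvdn_num_derangements[H _ _ _] qt; apply/H/(dvdn_trans qt).
have t_n2 q : (q %| n - 2)%N -> (q %| t)%N -> (q %| 1)%N.
  move=> /dvdn_num_derangements[_ H _ _] qt; move: H; rewrite -addn2 subnK ?(leq_trans _ n5) //.
  by apply; apply: dvdn_trans tD.
have t_n3 q : (q %| n - 3)%N -> (q %| t)%N -> (q %| 2)%N.
  move=> /dvdn_num_derangements[_ _ H _] qt; move: H; rewrite -addn3 subnK ?(leq_trans _ n5) //.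
  by apply; apply: dvdn_trans tD.
have t_n4 q : (q %| n - 4)%N -> (q %| t)%N -> (q %| 9)%N.
  move=> /dvdn_num_derangements[_ _ _ H] qt; move: H; rewrite -addn4 subnK ?(leq_trans _ n5) //.
  by apply; apply: dvdn_trans tD.
have trG : [transitive G, on [set: 'I_n] | 'P]%g.
  pose x0 : 'I_n := Ordinal (ltnW (ltnW (ltnW (ltnW n5)))).
  have : #|orbit 'P%act G x0| = n.
    apply: (orbit_size_eq t_n).
      have := max_card [in orbit 'P%act G x0]; rewrite card_n => ->; rewrite andbT.
      apply/card_gt0P; exists x0.
      exact: orbit_refl.
    by have := dvdn_bin_setstab (acts_orbit 'P%act x0 (subsetT G)); rewrite card_n.
  move=> cO; have <- : orbit 'P%act G x0 = setT.
    by apply/eqP; rewrite eqEcard subsetT cO cardsT card_n leqnn.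
  exact: atrans_orbit.
have prG : primitive_on G [set: 'I_n].
  apply/primitive_onP; split=> // B _ B1 bB; apply/eqP.
  rewrite eqEcard subsetT cardsT card_n leqNgt; apply/negP => Bn.
  have B0 : B != set0 by rewrite -card_gt0 ltnW.
  have B2 : #|B| = 2.
    apply: (block_size_eq2 n5 t_n2 t_n3); rewrite ?B1 //.
      by have := dvdn_card_block trG (subsetT B) B0 bB; rewrite cardsT card_n.
    by have := dvdn_bin_block trG B0 bB; rewrite card_n.
  have n_even : (2 %| n)%N.
    by have := dvdn_card_block trG (subsetT B) B0 bB; rewrite cardsT card_n B2.
  (* As [n] is even and at least 6, [n - 3] is odd and greater than 1, so [p] is an odd prime; a
     block of size 2 is too small for a [p]-cycle. *)
  pose p := pdiv (n - 3); have p_pr : prime p by apply: pdiv_prime; lia.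
  have p_n3 : (p %| n - 3)%N by apply: pdiv_dvd.
  have p_odd : p != 2 by apply: contraTneq p_n3 => ->; lia.
  have pt : ~~ (p %| t)%N by apply: contra p_odd => /(t_n3 _ p_n3); rewrite dvdn_prime2.
  have le_pn : (p <= #|'I_n|)%N.
    by rewrite card_n (leq_trans (dvdn_leq _ p_n3)) ?leq_subr // subn_gt0 (leq_trans _ n5).
  have [Y cY pF] := exists_prime_fixator p_pr le_pn pt.
  have := leq_prime_card_block trG B1 bB p_pr cY pF.
  by rewrite B2 leqNgt ltn_neqAle eq_sym p_odd prime_gt1.
have [n7|n7] := eqVneq n 7; last first.
  have [p [p_pr p_small le_pn pt]] := exists_prime_ndvd_index n5 t_n t_n2 t_n3 t_n4 n7.
  rewrite -card_n in le_pn; have [Y cY pF] := exists_prime_fixator p_pr le_pn pt.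
  by apply: (Alt_sub_primitive_cycle prG p_pr cY pF); rewrite card_n.
have pt : ~~ (5 %| t)%N by apply/negP => /(t_n2 5); rewrite n7 => /(_ isT).
have le_5n : (5 <= #|'I_n|)%N by rewrite card_n.
have [Y cY pF] := exists_prime_fixator (isT : prime 5) le_5n pt.
have prY : primitive_on 'C_G(~: Y | 'P)%g Y.
  by apply: primitive_on_prime; rewrite ?cY //; apply: atrans_prime_fixator pF.
have := card_primitive_fixator prG prY; rewrite cY => /(_ isT).
case/dvdnP: pF => r ->; rewrite card_n => cG.
have {}cG : (#|G| * 5`! = 7`! * (r * 5))%N by rewrite cG n7.
have LG : (#|G| * t = 7`!)%N by rewrite Lagrange ?subsetT // card_Sym card_n n7.
(* Replacing [7!] by [#|G| * t] in [cG] and cancelling [#|G|] leaves [5! = t * (r * 5)]. *)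
have t24 : (t %| 24)%N.
  have div24 g u : (0 < g)%N -> (g * u = 7`!)%N -> (g * 5`! = 7`! * (r * 5))%N -> (u %| 24)%N.
    move=> g0 <- /eqP; rewrite -mulnA eqn_pmul2l // !factS fact0 => /eqP E.
    by apply/dvdnP; exists r; move: E; clear; nia.
  exact: div24 (cardG_gt0 G) LG cG.
have t6 : (t %| 6)%N.
  by rewrite (_ : 6 = gcdn 24 1854) // dvdn_gcd t24 -num_derangements7 -n7.
apply: Alt_sub_small_index; rewrite card_n //.
by apply: leq_ltn_trans (dvdn_leq _ t6) _ => //; rewrite [X in (_ < X)%N]n7.
Qed.

(** * From rational proportions to divisibility by the index *)

Local Open Scope ring_scope.

Theorem mainTheorem3 (n : nat) (hn : (5 <= n)%N) (G : {group 'S_n}) :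
  ((denq ((num_derangements n)%:R / (n`!)%:R) %| #|G|%:Z)%Z ->
     (G :=: 'Alt_('I_n) \/ G :=: 'Sym_('I_n))%g)
  /\
  (forall C : {set 'S_n},
     #|C| = #|G| ->
     #|[set s in C | derangement s]|%:R / #|C|%:R
       = (num_derangements n)%:R / (n`!)%:R :> rat ->
     (G :=: 'Alt_('I_n) \/ G :=: 'Sym_('I_n))%g).
Proof.
have n0 : (n`!)%:R != 0 :> rat by rewrite Num.Theory.pnatr_eq0 -lt0n fact_gt0.
have G0 : #|G|%:R != 0 :> rat by rewrite Num.Theory.pnatr_eq0 -lt0n cardG_gt0.
(* Both hypotheses reduce to this divisibility, which after cancelling [#|G|] says that the index of
   [G] divides the derangement number. *)
have main : (n`! %| num_derangements n * #|G|)%N ->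
    (G :=: 'Alt_('I_n) \/ G :=: 'Sym_('I_n))%g.
  move=> nDG; apply: Alt_or_Sym; first by rewrite card_ord (leq_trans _ hn).
  apply: Alt_sub_dvd_num_derangements => //.
  rewrite -(dvdn_pmul2l (cardG_gt0 G)) Lagrange ?subsetT // card_Sym card_ord.
  by rewrite mulnC.
split=> [/dvdzP[k kE]|C cC CE]; apply: main.
  set x := _ / _ in kE.
  have : ((num_derangements n * #|G|)%N%:Z = (n`!)%:Z * (numq x * k))%R.
    apply: (@intr_inj rat); rewrite -pmulrn natrM [#|G|%:R]pmulrn kE !intrM numqE -pmulrn.
    have xE : (num_derangements n)%:R = x * (n`!)%:R by rewrite divfK.
    by rewrite xE; ring.
  by move/(congr1 absz) => /= E; apply/dvdnP; exists (absz (numq x * k)); rewrite E abszM mulnC.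
(* Only the integrality of the count matters: it is the quotient of [num_derangements n * #|G|] by
   [n!]. *)
apply/dvdnP; exists #|[set s in C | derangement s]|.
apply/eqP; rewrite -(@Num.Theory.eqr_nat rat) !natrM; apply/eqP; move: CE; rewrite cC => /eqP.
by rewrite eqr_div // => /eqP <-.
Qed.
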